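(* Let $\lambda$ be a regular cardinal with $\aleph_1<\lambda<2^{\aleph_0}$, let $\kappa<2^{\aleph_0}$, and let $d_i$ ($i<\kappa$) be metrics on $\lambda$. Then there is an ultrametric $d$ on $\lambda$ such that for no $i<\kappa$ and no $K\ge1$ is there an injection $f:\lambda\to\lambda$ with $d(x,y)/K\le d_i(f(x),f(y))\le K d(x,y)$ for all $x,y<\lambda$. In particular, there is no single metric space of cardinality $\lambda$ into which every ultrametric space of cardinality $\lambda$ is bi-Lipschitz embedded (and hence none into which every such space is almost isometrically embedded).
   Context: An ultrametric is a metric $d$ satisfying $d(x,z)\le\max\{d(x,y),d(y,z)\}$. A bi-Lipschitz embedding is an injection $f$ with $d(x,y)/K\le d'(f(x),f(y))\le Kd(x,y)$ for some constant $K\ge1$. $X$ is almost isometrically embedded in $Y$ if for every $\lambda>1$ there is an injection $f:X\to Y$ with $d(f(a),f(b))<\lambda d(a,b)$ and $d(a,b)<\lambda d(f(a),f(b))$ for distinct $a,b$. *)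

(* Defs.v *)
From Stdlib Require Import Reals.
Open Scope R_scope.

Definition card_le (A B : Type) : Prop := exists f : A -> B, forall x y, f x = f y -> x = y.
Definition card_lt (A B : Type) : Prop := card_le A B /\ ~ card_le B A.
Definition card_eq (A B : Type) : Prop :=
  exists f : A -> B, (forall x y, f x = f y -> x = y) /\ (forall b, exists a, f a = b).

Definition continuum : Type := nat -> bool.

Definition strict_well_order {L : Type} (lt : L -> L -> Prop) : Prop :=
  (forall x, ~ lt x x) /\
  (forall x y z, lt x y -> lt y z -> lt x z) /\
  (forall x y, lt x y \/ x = y \/ lt y x) /\
  well_founded lt.

(* (L, lt) is (the von Neumann ordinal of) a regular infinite cardinal lambda:
   a well-order all of whose proper initial segments have smaller cardinality
   (so its order type is an initial ordinal = a cardinal), and every cofinal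
   (unbounded) subset has full cardinality (cf(lambda) = lambda). *)
Definition regular_cardinal {L : Type} (lt : L -> L -> Prop) : Prop :=
  strict_well_order lt /\
  (forall a : L, card_lt {x : L | lt x a} L) /\
  (forall S : L -> Prop, (forall a, exists x, S x /\ lt a x) -> card_le L {x : L | S x}).

Definition aleph1_lt {L : Type} (lt : L -> L -> Prop) : Prop :=
  exists a : L, ~ card_le {x : L | lt x a} nat.

Definition is_metric {X : Type} (d : X -> X -> R) : Prop :=
  (forall x y, 0 <= d x y) /\
  (forall x y, d x y = 0 <-> x = y) /\
  (forall x y, d x y = d y x) /\
  (forall x y z, d x z <= d x y + d y z).

Definition is_ultrametric {X : Type} (d : X -> X -> R) : Prop :=
  is_metric d /\ (forall x y z, d x z <= Rmax (d x y) (d y z)).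

Definition bilip_embedding {X Y : Type} (d : X -> X -> R) (e : Y -> Y -> R)
  (K : R) (f : X -> Y) : Prop :=
  1 <= K /\ (forall x y, f x = f y -> x = y) /\
  (forall x y, d x y / K <= e (f x) (f y) <= K * d x y).

Definition almost_isometric_embeds {X Y : Type} (d : X -> X -> R) (e : Y -> Y -> R) : Prop :=
  forall lam : R, 1 < lam ->
    exists f : X -> Y, (forall x y, f x = f y -> x = y) /\
      (forall a b, a <> b -> e (f a) (f b) < lam * d a b /\ d a b < lam * e (f a) (f b)).

(* Main.v *)
Require Import Defs.
From mathcomp Require classical_sets.
From Stdlib Require Import Bool Reals Lra Lia Cantor Classical ClassicalEpsilon.
From Stdlib Require Import FunctionalExtensionality.
Open Scope R_scope.

(** Club guessing on [lambda > aleph_1] gives to each [x] a sequence [eta x] of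
    ordinals [<= x], injectively in [x], such that every club contains all values
    of some strictly increasing [eta x]. For a positive nonincreasing sequence [s],
    let [d x y] be [s n] with [n] the first difference of [eta x] and [eta y]. If
    [eta x] takes its values in the club of ordinals reflecting a [K]-bi-Lipschitz
    [f] into a metric [e], then the [e]-distance from [f x] to the set of ordinals
    below [eta x n] lies between [s n / (2 K)] and [K * s n]. Hence large jumps of
    [s] can be read off from [x], [f x] and [e], and a real [A] coded by the jumps
    is one of the at most [kappa * lambda < 2^aleph_0] reals decoded from the given
    metrics. Any real that is not among them yields the required ultrametric. *)

(** * Zorn's lemma for propositional relations *)

Definition decide_bool (P : Prop) : bool :=
  if excluded_middle_informative P then true else false.

Lemma decide_boolE (P : Prop) : decide_bool P = true <-> P.
Proof.
  unfold decide_bool; destruct (excluded_middle_informative P); split;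
    intros; auto; discriminate.
Qed.

Lemma zorn_preorder (T : Type) (t0 : T) (R : T -> T -> Prop) :
  (forall t, R t t) -> (forall r s t, R r s -> R s t -> R r t) ->
  (forall A : T -> Prop, (forall s t, A s -> A t -> R s t \/ R t s) ->
     exists t, forall s, A s -> R s t) ->
  exists t, forall s, R t s -> R s t.
Proof.
  intros Hr Ht Hc.
  destruct (@classical_sets.ZL_preorder T t0 (fun x y => decide_bool (R x y)))
    as [t Hmax].
  - intros t; apply decide_boolE, Hr.
  - intros r s t H1 H2; apply decide_boolE.
    apply (Ht r s t); now apply decide_boolE.
  - intros A HA; destruct (Hc A) as [t Hub].
    + intros s t As At.
      destruct (HA s t As At); [left|right]; now apply decide_boolE.
    + exists t; intros s As; now apply decide_boolE, Hub.
  - exists t; intros s Hs; apply decide_boolE, Hmax, decide_boolE, Hs.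
Qed.

(** * Cardinal arithmetic *)

Lemma card_le_trans (A B C : Type) : card_le A B -> card_le B C -> card_le A C.
Proof.
  intros [f Hf] [g Hg]; exists (fun x => g (f x)); auto.
Qed.

Lemma card_le_prod (A B C D : Type) :
  card_le A B -> card_le C D -> card_le (A * C) (B * D).
Proof.
  intros [f Hf] [g Hg]; exists (fun p => (f (fst p), g (snd p))).
  intros [a c] [a' c'] H; simpl in H; injection H as H1 H2; f_equal; auto.
Qed.

Lemma card_le_of_surjection (A B : Type) (f : A -> B) :
  (forall b, exists a, f a = b) -> card_le B A.
Proof.
  intros H; destruct (choice _ H) as [g Hg].
  exists g; intros x y Hxy; rewrite <- (Hg x), <- (Hg y); congruence.
Qed.

Definition partial_injection (A B : Type) (G : A -> B -> Prop) : Prop :=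
  (forall a b b', G a b -> G a b' -> b = b') /\
  (forall a a' b, G a b -> G a' b -> a = a').

Lemma card_le_total (A B : Type) : card_le A B \/ card_le B A.
Proof.
  set (T := {G : A -> B -> Prop | partial_injection A B G}).
  assert (t0 : T).
  { exists (fun _ _ => False); split; intros; contradiction. }
  destruct (zorn_preorder T t0
    (fun s t => forall a b, proj1_sig s a b -> proj1_sig t a b)) as [t Hmax].
  - auto.
  - auto.
  - intros C HC.
    assert (P : partial_injection A B (fun a b => exists s, C s /\ proj1_sig s a b)).
    { split.
      - intros a b b' [s [Cs H]] [s' [Cs' H']].
        destruct (HC s s' Cs Cs') as [L|L].
        + exact (proj1 (proj2_sig s') a b b' (L _ _ H) H').
        + exact (proj1 (proj2_sig s) a b b' H (L _ _ H')).
      - intros a a' b [s [Cs H]] [s' [Cs' H']].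
        destruct (HC s s' Cs Cs') as [L|L].
        + exact (proj2 (proj2_sig s') a a' b (L _ _ H) H').
        + exact (proj2 (proj2_sig s) a a' b H (L _ _ H')). }
    exists (exist _ _ P); simpl; intros s Cs a b H; exists s; auto.
  - destruct t as [G [Gf Gi]]; simpl in Hmax.
    destruct (classic (forall a, exists b, G a b)) as [Htot|Hnt].
    + left; destruct (choice _ Htot) as [f Hf]; exists f.
      intros x y E; apply (Gi x y (f x)); [apply Hf|rewrite E; apply Hf].
    + apply not_all_ex_not in Hnt; destruct Hnt as [a0 Ha0].
      right.
      destruct (classic (forall b, exists a, G a b)) as [Hsur|Hns].
      * destruct (choice _ Hsur) as [f Hf]; exists f.
        intros x y E; apply (Gf (f x) x y); [apply Hf|rewrite E; apply Hf].
      * exfalso; apply not_all_ex_not in Hns; destruct Hns as [b0 Hb0].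
        assert (P : partial_injection A B (fun a b => G a b \/ (a = a0 /\ b = b0))).
        { split.
          - intros a b b' [H|[-> ->]] [H'|[E ->]]; subst; eauto.
            + exfalso; eauto.
            + exfalso; eauto.
          - intros a a' b [H|[-> ->]] [H'|[-> E]]; subst; eauto.
            + exfalso; eauto.
            + exfalso; eauto. }
        apply Ha0; exists b0; apply (Hmax (exist _ _ P)); simpl; auto.
Qed.

(* Containing the range of [u] makes [P] infinite. *)
Definition pairing_on (M : Type) (u : nat -> M) (P : M -> Prop) (f : M -> M -> M) : Prop :=
  (forall n, P (u n)) /\
  (forall x y, P x -> P y -> P (f x y)) /\
  (forall x y x' y', P x -> P y -> P x' -> P y' ->
     f x y = f x' y' -> x = x' /\ y = y').

Lemma ex_pairing_on_range (M : Type) (u : nat -> M) :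
  (forall m n, u m = u n -> m = n) ->
  exists f, pairing_on M u (fun x => exists n, x = u n) f.
Proof.
  intros Hu.
  set (v := fun x => epsilon (inhabits 0%nat) (fun n => x = u n)).
  assert (Hv : forall n, v (u n) = n).
  { intros n; apply Hu; symmetry.
    apply (epsilon_spec (inhabits 0%nat) (fun k => u n = u k)); now exists n. }
  exists (fun x y => u (Cantor.to_nat (v x, v y))); repeat split.
  - intros n; now exists n.
  - intros; eexists; reflexivity.
  - destruct H as [a ->], H0 as [b ->], H1 as [a' ->], H2 as [b' ->].
    apply Hu, Cantor.to_nat_inj in H3; rewrite !Hv in H3; congruence.
  - destruct H as [a ->], H0 as [b ->], H1 as [a' ->], H2 as [b' ->].
    apply Hu, Cantor.to_nat_inj in H3; rewrite !Hv in H3; congruence.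
Qed.

(** Zorn's lemma on pairs of a domain and a pairing, ordered by extension, starting from Cantor's
    pairing on the range of [u]. *)
Lemma ex_maximal_pairing (M : Type) (u : nat -> M) :
  (forall m n, u m = u n -> m = n) ->
  exists P f, pairing_on M u P f /\
    forall Q g, pairing_on M u Q g -> (forall x, P x -> Q x) ->
      (forall x y, P x -> P y -> f x y = g x y) -> forall x, Q x -> P x.
Proof.
  intros Hu; destruct (ex_pairing_on_range M u Hu) as [f0 H0].
  set (T := {p : (M -> Prop) * (M -> M -> M) | pairing_on M u (fst p) (snd p)}).
  assert (t0 : T) by (exists (fun x => exists n, x = u n, f0); exact H0).
  destruct (zorn_preorder T t0 (fun s t =>
     (forall x, fst (proj1_sig s) x -> fst (proj1_sig t) x) /\
     (forall x y, fst (proj1_sig s) x -> fst (proj1_sig s) y ->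
        snd (proj1_sig s) x y = snd (proj1_sig t) x y))) as [t Hmax].
  - auto.
  - intros r s t [H1 H2] [H3 H4]; split; auto.
    intros x y Hx Hy; rewrite H2; auto.
  - intros C HC.
    destruct (classic (exists c, C c)) as [[c Cc]|Hn].
    2:{ exists t0; intros s Cs; exfalso; eauto. }
    set (P := fun x => exists s, C s /\ fst (proj1_sig s) x).
    (* Union of the chain of pairings: members containing both arguments agree on them, so [epsilon]
       picks their common value. *)
    set (f := fun x y => epsilon (inhabits (u 0%nat)) (fun z => exists s, C s /\
        fst (proj1_sig s) x /\ fst (proj1_sig s) y /\ z = snd (proj1_sig s) x y)).
    assert (Hf : forall s x y, C s -> fst (proj1_sig s) x -> fst (proj1_sig s) y ->
              f x y = snd (proj1_sig s) x y).
    { intros s x y Cs Hx Hy.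
      assert (E : exists z, exists s, C s /\
        fst (proj1_sig s) x /\ fst (proj1_sig s) y /\ z = snd (proj1_sig s) x y).
      { exists (snd (proj1_sig s) x y), s; auto. }
      apply (epsilon_spec (inhabits (u 0%nat))) in E.
      fold (f x y) in E; destruct E as [s' [Cs' [Hx' [Hy' E]]]]; rewrite E.
      destruct (HC s s' Cs Cs') as [[_ L]|[_ L]]; [symmetry|]; auto. }
    assert (Hd : forall s s', C s -> C s' -> exists r, C r /\
       (forall x, fst (proj1_sig s) x -> fst (proj1_sig r) x) /\
       (forall x, fst (proj1_sig s') x -> fst (proj1_sig r) x)).
    { intros s s' Cs Cs'; destruct (HC s s' Cs Cs') as [[L _]|[L _]]; eauto. }
    assert (HP : pairing_on M u P f).
    { split; [|split].
      - intros n; exists c; split; auto; apply (proj2_sig c).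
      - intros x y [s [Cs Hx]] [s' [Cs' Hy]].
        destruct (Hd s s' Cs Cs') as [r [Cr [L L']]].
        exists r; split; auto; rewrite (Hf r); auto.
        apply (proj2_sig r); auto.
      - intros x y x' y' [s1 [C1 X]] [s2 [C2 Y]] [s3 [C3 X']] [s4 [C4 Y']] E.
        destruct (Hd s1 s2 C1 C2) as [r [Cr [L1 L2]]].
        destruct (Hd s3 s4 C3 C4) as [r' [Cr' [L3 L4]]].
        destruct (Hd r r' Cr Cr') as [q [Cq [L L']]].
        rewrite !(Hf q) in E; auto.
        apply (proj2_sig q) in E; auto. }
    exists (exist _ (P, f) HP); intros s Cs; simpl; split.
    + intros x Hx; exists s; auto.
    + intros x y Hx Hy; symmetry; auto.
  - destruct t as [[P f] HP]; simpl in *.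
    exists P, f; split; auto.
    intros Q g HQ HPQ Hfg.
    destruct (Hmax (exist _ (Q, g) HQ)) as [H _]; simpl; auto.
Qed.

(* Hessenberg. If the complement of the domain [P] of a maximal pairing embeds
   in [P], then so does [M]; otherwise a copy [Q] of [P] outside [P] has room for
   the pairs of [P \cup Q] that are not yet used, against maximality. *)
Lemma card_le_square (M : Type) : card_le nat M -> card_le (M * M) M.
Proof.
  intros [u Hu].
  destruct (ex_maximal_pairing M u Hu) as [P [f [[Pu [Pf fi]] Hmax]]].
  assert (u01 : u 0%nat <> u 1%nat) by (intros E; apply Hu in E; discriminate).
  destruct (card_le_total {x | ~ P x} {x | P x}) as [[h Hh]|[h Hh]].
  (* [k] injects all of [M] into [P]: points of [P] are tagged with [u 0], the images under [h] of
     the others with [u 1]. *)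
  - set (k := fun x => match excluded_middle_informative (P x) with
      | left _ => f (u 0%nat) x
      | right n => f (u 1%nat) (proj1_sig (h (exist _ x n))) end).
    assert (Pk : forall x, P (k x)).
    { intros x; unfold k; destruct (excluded_middle_informative (P x)); auto.
      apply Pf; auto; apply proj2_sig. }
    assert (ki : forall x y, k x = k y -> x = y).
    { intros x y; unfold k; destruct (excluded_middle_informative (P x)) as [p|n],
        (excluded_middle_informative (P y)) as [p'|n']; intros E;
      apply fi in E; auto; try apply (proj2_sig (h _)); destruct E as [E1 E2]; auto;
      try (exfalso; congruence).
      assert (E : h (exist _ x n) = h (exist _ y n')).
      { destruct (h (exist _ x n)) as [a pa], (h (exist _ y n')) as [b pb].
        simpl in E2; subst b; f_equal; apply proof_irrelevance. }
      apply Hh in E; congruence. }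
    exists (fun p => f (k (fst p)) (k (snd p))).
    intros [x y] [x' y'] E; simpl in E; apply fi in E; auto.
    destruct E; f_equal; auto.
  - exfalso.
    set (Q := fun y => exists x, y = proj1_sig (h x)).
    assert (QP : forall y, Q y -> ~ P y).
    { intros y [x ->]; apply proj2_sig. }
    set (hh := fun x => match excluded_middle_informative (P x) with
      | left p => proj1_sig (h (exist _ x p)) | right _ => x end).
    assert (Qhh : forall x, P x -> Q (hh x)).
    { intros x p; unfold hh; destruct (excluded_middle_informative (P x));
        [eexists; reflexivity|contradiction]. }
    assert (hhi : forall x y, P x -> P y -> hh x = hh y -> x = y).
    { intros x y; unfold hh; destruct (excluded_middle_informative (P x)) as [p|n],
        (excluded_middle_informative (P y)) as [p'|n']; intros Hx Hy E; try contradiction.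
      assert (E' : h (exist _ x p) = h (exist _ y p')).
      { destruct (h (exist _ x p)) as [a pa], (h (exist _ y p')) as [b pb].
        simpl in E; subst b; f_equal; apply proof_irrelevance. }
      apply Hh in E'; congruence. }
    assert (hinv : forall y, exists x, Q y -> P x /\ y = hh x).
    { intros y; destruct (classic (Q y)) as [[[x p] E]|n].
      - exists x; intros _; split; auto; unfold hh.
        destruct (excluded_middle_informative (P x)) as [p'|]; [|contradiction].
        rewrite E; do 3 f_equal; apply proof_irrelevance.
      - exists y; intros; contradiction. }
    destruct (choice _ hinv) as [g Hg].
    (* Same tagging for the union of [P] and its copy [Q], with [g] undoing [hh]. *)
    set (k := fun x => if excluded_middle_informative (P x)
                       then f (u 0%nat) x else f (u 1%nat) (g x)).
    set (PQ := fun x => P x \/ Q x).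
    assert (Pk : forall x, PQ x -> P (k x)).
    { intros x Hx; unfold k; destruct (excluded_middle_informative (P x)); auto.
      destruct Hx as [|q]; [contradiction|]; apply Pf; auto; now apply Hg. }
    assert (ki : forall x y, PQ x -> PQ y -> k x = k y -> x = y).
    { intros x y Hx Hy; unfold k.
      destruct (excluded_middle_informative (P x)) as [p|n],
        (excluded_middle_informative (P y)) as [p'|n']; intros E.
      - apply fi in E; auto; tauto.
      - destruct Hy as [|q]; [contradiction|]; apply Hg in q.
        apply fi in E; auto; try tauto; destruct E; exfalso; congruence.
      - destruct Hx as [|q]; [contradiction|]; apply Hg in q.
        apply fi in E; auto; try tauto; destruct E; exfalso; congruence.
      - destruct Hy as [|q]; [contradiction|]; apply Hg in q.
        destruct Hx as [|q']; [contradiction|]; apply Hg in q'.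
        apply fi in E; auto; try tauto; destruct E, q as [_ q], q' as [_ q']; congruence. }
    (* The new pairs take values in [Q], the old ones in [P], so the two cases never collide. *)
    set (f' := fun x y => if excluded_middle_informative (P x /\ P y)
                          then f x y else hh (f (k x) (k y))).
    assert (HQ : pairing_on M u PQ f').
    { split; [|split].
      - left; auto.
      - intros x y Hx Hy; unfold f'.
        destruct (excluded_middle_informative (P x /\ P y)) as [[]|]; [left|right]; auto.
      - intros x y x' y' Hx Hy Hx' Hy'; unfold f'.
        destruct (excluded_middle_informative (P x /\ P y)) as [[]|],
          (excluded_middle_informative (P x' /\ P y')) as [[]|]; intros E.
        + apply fi; auto.
        + exfalso; apply (QP (f x y)); [rewrite E|]; auto.
        + exfalso; apply (QP (f x' y')); [rewrite <- E|]; auto.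
        + apply hhi in E; auto; apply fi in E; auto; destruct E; auto. }
    apply (QP (hh (u 0%nat))); auto.
    apply (Hmax PQ f'); auto.
    + intros x; now left.
    + intros x y Hx Hy; unfold f'.
      destruct (excluded_middle_informative (P x /\ P y)) as [[]|]; tauto.
    + right; auto.
Qed.

(** By totality the product embeds in the square of the larger factor; that square embeds in the
    factor itself if [nat] does, and in [nat] otherwise. *)
Lemma not_card_le_prod (C A B : Type) :
  ~ card_le C nat -> ~ card_le C A -> ~ card_le C B -> ~ card_le C (A * B).
Proof.
  assert (Sq : forall M, ~ card_le C nat -> ~ card_le C M -> ~ card_le C (M * M)).
  { intros M Hn HM H.
    destruct (card_le_total nat M) as [L|L].
    - apply HM, (card_le_trans _ _ _ H), card_le_square, L.
    - apply Hn, (card_le_trans _ _ _ H), (card_le_trans _ (nat * nat)).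
      + now apply card_le_prod.
      + apply card_le_square; exists (fun n => n); auto. }
  assert (refl : forall M, card_le M M) by (intros M; exists (fun x => x); auto).
  intros Hn HA HB H; destruct (card_le_total A B) as [L|L].
  - apply (Sq B Hn HB), (card_le_trans _ _ _ H), card_le_prod; auto.
  - apply (Sq A Hn HA), (card_le_trans _ _ _ H), card_le_prod; auto.
Qed.

(** * Closed unbounded sets and club guessing *)

Section RegularCardinal.

Variables (L : Type) (lt : L -> L -> Prop).
Hypothesis Lreg : regular_cardinal lt.
Hypothesis Lal : aleph1_lt lt.

Lemma lt_irr x : ~ lt x x.
Proof. apply Lreg. Qed.

Lemma lt_tr x y z : lt x y -> lt y z -> lt x z.
Proof. apply Lreg. Qed.

Lemma lt_tot x y : lt x y \/ x = y \/ lt y x.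
Proof. apply Lreg. Qed.

Lemma lt_wf : well_founded lt.
Proof. apply Lreg. Qed.

Lemma le_lt_tr x y z : ~ lt y x -> lt y z -> lt x z.
Proof.
  intros H1 H2; destruct (lt_tot x y) as [H|[->|H]]; eauto using lt_tr; tauto.
Qed.

Lemma lt_le_tr x y z : lt x y -> ~ lt z y -> lt x z.
Proof.
  intros H1 H2; destruct (lt_tot y z) as [H|[->|H]]; eauto using lt_tr; tauto.
Qed.

Lemma le_antisym x y : ~ lt x y -> ~ lt y x -> x = y.
Proof. destruct (lt_tot x y) as [H|[H|H]]; tauto. Qed.

Lemma lt_le x y : lt x y -> ~ lt y x.
Proof. intros H H'; apply (lt_irr x); eauto using lt_tr. Qed.

Lemma ex_least (P : L -> Prop) x : P x -> exists m, P m /\ forall y, P y -> ~ lt y m.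
Proof.
  revert x; apply (well_founded_ind lt_wf (fun x => P x -> _)).
  intros x IH Hx; destruct (classic (exists y, P y /\ lt y x)) as [[y [Py H]]|H].
  - eauto.
  - exists x; split; auto; intros y Py Hy; eauto.
Qed.

Lemma not_card_le_nat : ~ card_le L nat.
Proof.
  intros H; destruct Lal as [a Ha]; apply Ha; refine (card_le_trans _ _ _ _ H).
  exists (@proj1_sig _ _); intros [x p] [y q] E; simpl in E; subst y.
  f_equal; apply proof_irrelevance.
Qed.

Lemma not_card_le_segment a : ~ card_le L {x | lt x a}.
Proof. apply Lreg. Qed.

(** If [a] were the maximum, [L] would be its segment plus one point, too small: it embeds in the
    segment times [nat], or is a singleton when the segment is empty. *)
Lemma ex_gt a : exists b, lt a b.
Proof.
  apply NNPP; intros H.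
  destruct (classic (exists x, lt x a)) as [[x0 Hx0]|Hn].
  - apply (not_card_le_prod L {x | lt x a} nat); auto using not_card_le_nat,
      not_card_le_segment.
    exists (fun x => match excluded_middle_informative (lt x a) with
       | left p => (exist (fun x => lt x a) x p, 0%nat)
       | right _ => (exist (fun x => lt x a) x0 Hx0, 1%nat) end).
    intros x y; destruct (excluded_middle_informative (lt x a)) as [p|p],
      (excluded_middle_informative (lt y a)) as [q|q]; intros E; try congruence.
    apply le_antisym; intros K.
    + destruct (lt_tot y a) as [Q|[Q|Q]]; subst; eauto.
    + destruct (lt_tot x a) as [Q|[Q|Q]]; subst; eauto.
  - apply not_card_le_nat; exists (fun _ => 0%nat); intros x y _.
    assert (E : forall z, z = a) by
      (intros z; apply le_antisym; eauto). rewrite (E x), (E y); reflexivity.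
Qed.

Lemma ex_gt2 a b : exists c, lt a c /\ lt b c.
Proof.
  destruct (ex_gt a) as [a' Ha], (ex_gt b) as [b' Hb].
  destruct (classic (lt a' b')) as [H|H]; [exists b'|exists a'];
    eauto using lt_tr, lt_le_tr.
Qed.

(** The range of an unbounded family is cofinal, so by regularity [L] embeds in it, and hence in the
    index type. *)
Lemma bounded_family (T : Type) (f : T -> L) :
  ~ card_le L T -> exists b, forall t, lt (f t) b.
Proof.
  intros HT; apply NNPP; intros Hb; apply HT.
  destruct Lreg as [_ [_ H]].
  refine (card_le_trans _ _ _ (H (fun x => exists t, f t = x) _) _).
  - intros a; destruct (ex_gt a) as [b Hab].
    apply NNPP; intros Hn; apply Hb; exists b; intros t.
    refine (le_lt_tr _ _ _ _ Hab).
    intros K; apply Hn; exists (f t); eauto.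
  - apply (card_le_of_surjection T _ (fun t =>
      exist (fun x => exists t, f t = x) (f t) (ex_intro _ t eq_refl))).
    intros [x [t <-]]; exists t; reflexivity.
Qed.

Lemma bounded_segment a (f : L -> L) : exists b, forall x, lt x a -> lt (f x) b.
Proof.
  destruct (bounded_family {x | lt x a} (fun x => f (proj1_sig x))) as [b Hb].
  - apply not_card_le_segment.
  - exists b; intros x Hx; exact (Hb (exist _ x Hx)).
Qed.

Lemma bounded_segment_le a (f : L -> L) : exists b, forall x, ~ lt a x -> lt (f x) b.
Proof.
  destruct (ex_gt a) as [a' H], (bounded_segment a' f) as [b Hb].
  exists b; eauto using le_lt_tr.
Qed.

Lemma bounded_sequence (u : nat -> L) : exists b, forall n, lt (u n) b.
Proof. apply bounded_family, not_card_le_nat. Qed.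

(** A witness that [a] is a limit of cofinality omega; [u] itself need not be monotone. *)
Definition ladder (u : nat -> L) (a : L) : Prop :=
  (forall n, lt (u n) a) /\ (forall b, lt b a -> exists n, lt b (u n)).

Lemma ex_sup (u : nat -> L) : (forall n, lt (u n) (u (S n))) -> exists s, ladder u s.
Proof.
  intros Hu; destruct (bounded_sequence u) as [b0 Hb0].
  destruct (ex_least (fun b => forall n, lt (u n) b) b0 Hb0) as [s [Hs Hm]].
  exists s; split; auto; intros b Hb; apply NNPP; intros Hn.
  apply (Hm b); auto; intros n.
  refine (lt_le_tr _ _ _ (Hu n) _); eauto.
Qed.

Lemma ex_iteration (R : L -> L -> Prop) a :
  (forall x, exists y, lt x y /\ R x y) ->
  exists u, u 0%nat = a /\ forall n, lt (u n) (u (S n)) /\ R (u n) (u (S n)).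
Proof.
  intros H; destruct (choice _ H) as [g Hg].
  exists (fun n => Nat.iter n g a); split; auto; intros n; apply Hg.
Qed.

Definition limit_point (E : L -> Prop) (a : L) : Prop :=
  forall b, lt b a -> exists e, E e /\ lt b e /\ lt e a.

(* The least element is vacuously a limit point, so it belongs to every club. *)
Definition club (E : L -> Prop) : Prop :=
  (forall a, limit_point E a -> E a) /\ (forall a, exists e, E e /\ lt a e).

(** The common shape of the unboundedness proofs: climb from [a] along [R] in omega steps and take
    the supremum. *)
Lemma club_diagonal (R : L -> L -> Prop) (E : L -> Prop) :
  (forall x, exists y, R x y) ->
  (forall x y z, R x y -> lt y z -> R x z) ->
  (forall u s, ladder u s -> (forall n, lt (u n) (u (S n)) /\ R (u n) (u (S n))) -> E s) ->
  forall a, exists e, E e /\ lt a e.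
Proof.
  intros HR Hmon HE a; destruct (ex_iteration R a) as [u [H0 Hu]].
  { intros x; destruct (HR x) as [y Hy], (ex_gt2 x y) as [z [H1 H2]]; eauto. }
  destruct (ex_sup u) as [s Hs]; [apply Hu|].
  exists s; split; eauto; rewrite <- H0; apply Hs.
Qed.

Lemma club_intersection (F : L -> L -> Prop) a :
  (forall j, lt j a -> club (F j)) -> club (fun x => forall j, lt j a -> F j x).
Proof.
  intros HF; split.
  - intros x Hx j Hj; apply HF; auto; intros b Hb.
    destruct (Hx b Hb) as [e [He1 He2]]; eauto.
  (* One step passes a point of every [F j] with [j] below [a], possible by regularity; the supremum
     of the steps is then a limit point of each [F j]. *)
  - apply (club_diagonal (fun x y =>
      forall j, lt j a -> exists e, F j e /\ lt x e /\ lt e y)).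
    + intros x.
      assert (H : forall j, exists e, lt j a -> F j e /\ lt x e).
      { intros j; destruct (classic (lt j a)) as [Hj|Hj].
        - destruct (proj2 (HF j Hj) x) as [e He]; eauto.
        - exists x; tauto. }
      destruct (choice _ H) as [g Hg], (bounded_segment a g) as [b Hb].
      exists b; intros j Hj; exists (g j); destruct (Hg j Hj); auto.
    + intros x y z H Hyz j Hj; destruct (H j Hj) as [e [H1 [H2 H3]]].
      exists e; eauto using lt_tr.
    + intros u s [Hs Hs'] Hu j Hj; apply (HF j Hj); intros b Hb.
      destruct (Hs' b Hb) as [n Hn], (proj2 (Hu n) j Hj) as [e [H1 [H2 H3]]].
      exists e; eauto using lt_tr.
Qed.

Lemma club_closure_points (B : L -> L) : club (fun a => forall x, lt x a -> lt (B x) a).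
Proof.
  split.
  - intros a Ha x Hx; destruct (Ha x Hx) as [e [H1 [H2 H3]]]; eauto using lt_tr.
  - apply (club_diagonal (fun y z => forall x, ~ lt y x -> lt (B x) z)).
    + intros y; apply bounded_segment_le.
    + eauto using lt_tr.
    + intros u s [Hs Hs'] Hu x Hx; destruct (Hs' x Hx) as [n Hn].
      apply lt_tr with (u (S n)); auto; apply Hu, lt_le, Hn.
Qed.

(** * Last points of a club and club guessing *)

Definition last_point (E : L -> Prop) (g m : L) : Prop :=
  E m /\ ~ lt g m /\ forall e, E e -> ~ lt g e -> ~ lt m e.

(** The supremum [a] of the points of [E] up to [g] lies in [E]: if not, it would not be a limit
    point of [E], and a smaller bound would exist. *)
Lemma ex_last_point E g : club E -> exists m, last_point E g m.
Proof.
  intros [Ecl _].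
  destruct (ex_least (fun a => forall e, E e -> ~ lt g e -> ~ lt a e) g)
    as [a [Ha Hmin]]; [auto|].
  assert (Hga : ~ lt g a) by (apply Hmin; auto).
  exists a; repeat split; auto.
  apply NNPP; intros HE; apply HE, Ecl; intros b Hb.
  apply NNPP; intros Hn; apply (Hmin b); auto; intros e Ee Hge Hbe.
  apply Hn; exists e; repeat split; auto.
  destruct (lt_tot e a) as [H|[->|H]]; auto; [contradiction|].
  exfalso; eapply Ha; eauto.
Qed.

Lemma last_point_unique E g m m' : last_point E g m -> last_point E g m' -> m = m'.
Proof.
  intros [H1 [H2 H3]] [H4 [H5 H6]]; apply le_antisym; auto.
Qed.

(** Take the least [a] with an uncountable segment. A sequence cofinal in it would make that segment
    a countable union of countable sets. *)
Lemma ex_omega1 : exists a, (exists z, lt z a) /\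
  forall u : nat -> L, (forall n, lt (u n) a) ->
    exists i, lt i a /\ forall n, lt (u n) i.
Proof.
  destruct Lal as [a0 Ha0].
  destruct (ex_least (fun a => ~ card_le {x | lt x a} nat) a0 Ha0) as [a [Ha Hmin]].
  exists a; split.
  - apply NNPP; intros H; apply Ha; exists (fun _ => 0%nat).
    intros [x Hx]; exfalso; eauto.
  - intros u Hu; apply NNPP; intros Hn; apply Ha.
    assert (Hc : forall n, exists f : L -> nat,
      forall x y, lt x (u n) -> lt y (u n) -> f x = f y -> x = y).
    { intros n; assert (H : card_le {x | lt x (u n)} nat).
      { apply NNPP; intros H; exact (Hmin _ H (Hu n)). }
      destruct H as [f Hf].
      exists (fun x => match excluded_middle_informative (lt x (u n)) with
        | left p => f (exist _ x p) | right _ => 0%nat end).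
      intros x y Hx Hy; destruct (excluded_middle_informative (lt x (u n))),
        (excluded_middle_informative (lt y (u n))); try contradiction.
      intros E; apply Hf in E; congruence. }
    destruct (choice _ Hc) as [f Hf].
    assert (Hk : forall x : {x | lt x a}, exists n, ~ lt (u n) (proj1_sig x)).
    { intros [x Hx]; simpl; apply not_all_ex_not; intros H; apply Hn; eauto. }
    destruct (choice _ Hk) as [k Hk'].
    (* A point at most [u (k x)] is coded by [k x] and its number below [u (k x)], shifted by one so
       that 0 is free for [u (k x)] itself. *)
    exists (fun x => Cantor.to_nat (k x,
      if excluded_middle_informative (proj1_sig x = u (k x)) then 0%nat
      else S (f (k x) (proj1_sig x)))).
    intros x y E; apply Cantor.to_nat_inj in E; injection E as E1 E2.
    assert (Exy : proj1_sig x = proj1_sig y).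
    { specialize (Hk' x) as Hx; specialize (Hk' y) as Hy.
      rewrite <- E1 in E2, Hy.
      destruct (excluded_middle_informative (proj1_sig x = u (k x))),
        (excluded_middle_informative (proj1_sig y = u (k x))); try congruence.
      injection E2 as E2; apply Hf in E2; auto.
      - destruct (lt_tot (proj1_sig x) (u (k x))) as [|[|]]; tauto.
      - destruct (lt_tot (proj1_sig y) (u (k x))) as [|[|]]; tauto. }
    destruct x as [x p], y as [y q]; simpl in Exy; subst y.
    f_equal; apply proof_irrelevance.
Qed.

(* Shelah's argument: if every club failed, iterate the failure omega_1 times to
   get a decreasing sequence [En]; at a limit point [d] of the
   intersection, each of the countably many last points below a ladder on [d]
   decreases, hence stabilises at a common stage before omega_1, where nothing fails. *)
Lemma ex_guessing_club (c : L -> nat -> L) :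
  (forall d, (exists u, ladder u d) -> ladder (c d) d) ->
  exists E, club E /\ forall E', club E' ->
    exists d, (exists u, ladder u d) /\ limit_point E d /\
      forall n m, last_point E (c d n) m -> E' m.
Proof.
  intros Hc; apply NNPP; intros Hfail.
  assert (HF : forall E, exists E', club E -> club E' /\
    forall d, (exists u, ladder u d) -> limit_point E d ->
      exists n m, last_point E (c d n) m /\ ~ E' m).
  { intros E; apply NNPP; intros Hn; apply Hfail; exists E; split.
    - apply NNPP; intros H; apply Hn; exists E; intros; contradiction.
    - intros E' HE'; apply NNPP; intros H; apply Hn; exists E'; intros _; split; auto.
      intros d Hd Hacc; apply NNPP; intros H'; apply H; exists d; repeat split; auto.
      intros n m Hm; apply NNPP; intros Hm'; apply H'; eauto. }
  destruct (choice _ HF) as [F HF']; clear HF Hfail.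
  set (En := Fix lt_wf (fun _ => L -> Prop)
    (fun i rec x => forall j (p : lt j i), F (rec j p) x)).
  assert (HEn : forall i, En i = fun x => forall j, lt j i -> F (En j) x).
  { intros i; unfold En at 1; rewrite Fix_eq; [reflexivity|].
    intros x f g Hfg; replace g with f; [reflexivity|].
    apply functional_extensionality_dep; intros y.
    apply functional_extensionality_dep; intros p; apply Hfg. }
  assert (Hclub : forall i, club (En i)).
  { intros i; induction (lt_wf i) as [i _ IH]; rewrite HEn.
    apply (club_intersection (fun j => F (En j))); intros j Hj; apply HF'; auto. }
  assert (Hdec : forall i j x, ~ lt j i -> En j x -> En i x).
  { intros i j x Hij; rewrite !HEn; intros H k Hk; eauto using lt_le_tr. }
  destruct ex_omega1 as [a [[z Hz] Ha]].
  (* The terms of [u] after the first lie in [En a], hence in every earlier [En j], so their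
     supremum [d] is a limit point of all of these. *)
  destruct (ex_iteration (fun _ y => En a y) a) as [u [_ Hu]].
  { intros x; destruct (proj2 (Hclub a) x) as [y []]; eauto. }
  destruct (ex_sup u) as [d Hd]; [apply Hu|].
  assert (Hacc : forall j, lt j a -> limit_point (En j) d).
  { intros j Hj b Hb; destruct (proj2 Hd b Hb) as [n Hn].
    exists (u (S n)); repeat split; [|eapply lt_tr; [exact Hn|apply Hu]|apply Hd].
    apply Hdec with a; [apply lt_le, Hj|apply Hu]. }
  assert (Hst : forall n, exists i, lt i a /\ exists m, forall j, ~ lt j i -> lt j a ->
     last_point (En j) (c d n) m).
  { intros n; destruct (ex_last_point (En z) (c d n) (Hclub z)) as [m1 Hm1].
    destruct (ex_least (fun m => exists i, lt i a /\ last_point (En i) (c d n) m) m1)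
      as [m [[i [Hi Hm]] Hmin]]; [eauto|].
    exists i; split; auto; exists m; intros j Hij Hja.
    destruct (ex_last_point (En j) (c d n) (Hclub j)) as [m' Hm'].
    replace m with m'; auto; apply le_antisym; [apply Hmin; eauto|].
    destruct Hm' as [H1 [H2 _]]; apply Hm; auto; eapply Hdec; eauto. }
  destruct (choice _ Hst) as [i Hi].
  destruct (Ha i) as [i1 [Hi1 Hii1]]; [apply Hi|].
  (* At [i2], one stage past [i1] but still below omega_1, the last points are those at [i1]; yet
     [En i2] is contained in [F (En i1)], which should miss one of them. *)
  destruct (Ha (fun _ => i1)) as [i2 [Hi2 Hi12]]; [auto|]; specialize (Hi12 0%nat).
  destruct (proj2 (HF' (En i1) (Hclub i1)) d) as [n [m [Hm HFm]]]; eauto.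
  destruct (Hi n) as [_ [m' Hm']].
  apply HFm; rewrite (last_point_unique _ _ _ _ Hm (Hm' i1 (lt_le _ _ (Hii1 n)) Hi1)).
  destruct (Hm' i2) as [H _]; auto.
  - apply lt_le; eauto using lt_tr.
  - rewrite HEn in H; auto.
Qed.

(** Above any [y] and [c n] below [d] there is a point of [E] below [d], and the last point under
    any later [c k] is at least that high. Repeating this gives a strictly increasing ladder. *)
Lemma ex_ladder_through_last_points E (c : nat -> L) d :
  club E -> ladder c d -> limit_point E d ->
  exists v, (exists b, lt b (v 0%nat)) /\ (forall n, lt (v n) (v (S n))) /\ ladder v d /\
    forall n, exists k, last_point E (c k) (v n).
Proof.
  intros HE [Hc Hc'] Hacc.
  assert (Hg : forall p : nat * L, exists z, lt (snd p) d ->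
    lt z d /\ lt (snd p) z /\ lt (c (fst p)) z /\ exists k, last_point E (c k) z).
  { intros [n y]; simpl; destruct (classic (lt y d)) as [Hy|Hy]; [|exists y; tauto].
    (* [b] is the maximum of [y] and [c n]. *)
    assert (Hb : exists b, lt b d /\ ~ lt b y /\ ~ lt b (c n)).
    { destruct (classic (lt y (c n))) as [H|H]; [exists (c n)|exists y];
        auto using lt_irr, lt_le. }
    destruct Hb as [b [Hb [H1 H2]]], (Hacc b Hb) as [e [He [Hbe Hed]]].
    destruct (Hc' e Hed) as [k Hk], (ex_last_point E (c k) HE) as [m Hm].
    assert (Hbm : lt b m).
    { apply lt_le_tr with e; auto; apply Hm; auto using lt_le. }
    exists m; intros _; repeat split; eauto using le_lt_tr.
    apply le_lt_tr with (c k); auto; apply Hm. }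
  destruct (choice _ Hg) as [g Hg'].
  set (v := fix v n := match n with 0%nat => g (0%nat, c 0%nat)
                       | S n => g (S n, v n) end).
  assert (Hv : forall n, lt (v n) d).
  { induction n; simpl; [|apply Hg'; assumption]; apply Hg'; simpl; auto. }
  exists v; repeat split; auto.
  - exists (c 0%nat); simpl; apply (Hg' (0%nat, c 0%nat)); simpl; auto.
  - intros n; simpl; apply (Hg' (S n, v n)); simpl; auto.
  - intros b Hb; destruct (Hc' b Hb) as [n Hn]; exists n; apply lt_tr with (c n); auto.
    destruct n; simpl; [apply (Hg' (0%nat, c 0%nat))|apply (Hg' (S n, v n))]; simpl; auto.
  - intros n; destruct n; simpl;
      [apply (Hg' (0%nat, c 0%nat))|apply (Hg' (S n, v n))]; simpl; auto.
Qed.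

(** [eta d] is a ladder of last points when [d] is a limit point of the guessing club of cofinality
    omega, and constantly [d] otherwise. A ladder determines its supremum and is never constant,
    whence injectivity. *)
Lemma ex_guessing_sequences : exists eta : L -> nat -> L,
  (forall x n, ~ lt x (eta x n)) /\
  (forall x y, (forall n, eta x n = eta y n) -> x = y) /\
  (forall E, club E -> exists x, (exists b, lt b (eta x 0%nat)) /\
     (forall n, lt (eta x n) (eta x (S n))) /\ forall n, E (eta x n)).
Proof.
  assert (Hc : forall d, exists u, (exists v, ladder v d) -> ladder u d).
  { intros d; destruct (classic (exists v, ladder v d)) as [[v Hv]|H];
      [exists v|exists (fun _ => d)]; tauto. }
  destruct (choice _ Hc) as [c Hc'].
  destruct (ex_guessing_club c Hc') as [E [HE Hguess]].
  set (good := fun d => (exists v, ladder v d) /\ limit_point E d).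
  assert (Hv : forall d, exists v, (good d /\ (exists b, lt b (v 0%nat)) /\
      (forall n, lt (v n) (v (S n))) /\ ladder v d /\
      forall n, exists k, last_point E (c d k) (v n)) \/ (~ good d /\ forall n, v n = d)).
  { intros d; destruct (classic (good d)) as [[Hd Hacc]|H].
    - destruct (ex_ladder_through_last_points E (c d) d) as [v Hv]; auto.
      exists v; left; split; auto; split; auto.
    - exists (fun _ => d); auto. }
  destruct (choice _ Hv) as [eta Heta].
  exists eta; repeat split.
  - intros x n; destruct (Heta x) as [[_ [_ [_ [Hl _]]]]|[_ Hl]].
    + apply lt_le, Hl.
    + rewrite Hl; apply lt_irr.
  - assert (Hlt : forall x y, (forall n, eta x n = eta y n) -> ~ lt x y).
    { intros x y E0 H.
      destruct (Heta x) as [[_ [_ [Hi [Hl _]]]]|[_ Hl]],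
        (Heta y) as [[_ [_ [Hi' [Hl' _]]]]|[_ Hl']].
      - destruct (proj2 Hl' x H) as [n Hn]; rewrite <- E0 in Hn.
        apply (lt_le _ _ Hn), Hl.
      - specialize (Hi 0%nat); rewrite !E0, !Hl' in Hi; exact (lt_irr _ Hi).
      - specialize (Hi' 0%nat); rewrite <- !E0, !Hl in Hi'; exact (lt_irr _ Hi').
      - rewrite <- (Hl 0%nat), E0, Hl' in H; exact (lt_irr _ H). }
    intros x y E0; apply le_antisym; apply Hlt; auto.
  - intros E' HE'; destruct (Hguess E' HE') as [d [Hd [Hacc HdE']]].
    exists d; destruct (Heta d) as [[_ [H0 [Hi [Hl Hk]]]]|[Hn _]].
    + repeat split; auto; intros n; destruct (Hk n); eauto.
    + exfalso; apply Hn; split; auto.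
Qed.

(** * Prefixes and reflection *)

Definition agree (eta : L -> nat -> L) (n : nat) (x y : L) : Prop :=
  forall k, (k < n)%nat -> eta x k = eta y k.

Lemma ex_prefix_bound (eta : L -> nat -> L) b n :
  exists c, forall z, (forall k, (k < n)%nat -> ~ lt b (eta z k)) ->
    exists z', lt z' c /\ agree eta n z' z.
Proof.
  induction n as [|n [c0 IH]].
  - destruct (ex_gt b) as [c Hc]; exists c; intros z _; exists b; split; auto.
    intros k Hk; lia.
  - assert (HW : forall p : L * L, exists w, (exists w', agree eta n w' (fst p) /\
        eta w' n = snd p) -> agree eta n w (fst p) /\ eta w n = snd p).
    { intros p; destruct (classic (exists w', agree eta n w' (fst p) /\
        eta w' n = snd p)) as [[w Hw]|H]; [exists w|exists b]; tauto. }
    (* [W] picks a representative for each prefix, given by a representative of its first [n]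
       entries and its last entry. Regularity bounds these first over last entries up to [b], then
       over representatives below [c0]. *)
    destruct (choice _ HW) as [W HW'].
    destruct (choice _ (fun z => bounded_segment_le b (fun v => W (z, v)))) as [C HC].
    destruct (bounded_segment c0 C) as [c Hc].
    exists c; intros z Hz; destruct (IH z) as [z' [Hz' Ha]].
    { intros k Hk; apply Hz; lia. }
    destruct (HW' (z', eta z n)) as [H1 H2]; simpl.
    { exists z; split; auto; intros k Hk; symmetry; auto. }
    simpl in H1, H2; exists (W (z', eta z n)); split.
    + apply lt_tr with (C z'); auto.
    + intros k Hk; destruct (PeanoNat.Nat.eq_dec k n) as [->|Hne]; auto.
      rewrite H1, Ha; auto; lia.
Qed.

(** Points of [E] behave like elementary submodels: they are closed under [f], under witnesses for
    [Q], and under realising bounded prefixes. [E] consists of the closure points of a function [B]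
    bounding all witnesses with parameter [w]. *)
Lemma ex_reflecting_club (eta : L -> nat -> L) (f : L -> L) (Q : nat -> L -> L -> Prop) :
  exists E, club E /\ forall a, E a ->
    (forall w, lt w a -> lt (f w) a) /\
    (forall j w, lt w a -> (exists x, Q j w x) -> exists x, lt x a /\ Q j w x) /\
    (forall b n z, lt b a -> (forall k, (k < n)%nat -> ~ lt b (eta z k)) ->
       exists z', lt z' a /\ agree eta n z' z).
Proof.
  assert (HB : forall w, exists B, lt (f w) B /\
    (forall j, (exists x, Q j w x) -> exists x, lt x B /\ Q j w x) /\
    (forall n z, (forall k, (k < n)%nat -> ~ lt w (eta z k)) ->
       exists z', lt z' B /\ agree eta n z' z)).
  { intros w.
    destruct (choice _ (ex_prefix_bound eta w)) as [p Hp].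
    destruct (bounded_sequence p) as [c1 Hc1].
    assert (HX : forall j, exists x, (exists x, Q j w x) -> Q j w x).
    { intros j; destruct (classic (exists x, Q j w x)) as [[x Hx]|H];
        [exists x|exists w]; tauto. }
    destruct (choice _ HX) as [X HX'], (bounded_sequence X) as [c2 Hc2].
    destruct (ex_gt2 c1 c2) as [c3 [H1 H2]], (ex_gt2 c3 (f w)) as [B [H3 H4]].
    exists B; repeat split; auto.
    - intros j Hj; exists (X j); split; eauto using lt_tr.
    - intros n z Hz; destruct (Hp n z Hz) as [z' [Hz' Ha]].
      exists z'; eauto 6 using lt_tr. }
  destruct (choice _ HB) as [B HB'].
  exists (fun a => forall x, lt x a -> lt (B x) a); split; [apply club_closure_points|].
  intros a Ha; repeat split.
  - intros w Hw; apply lt_tr with (B w); auto; apply HB'.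
  - intros j w Hw Hx; destruct (proj1 (proj2 (HB' w)) j Hx) as [x [H1 H2]].
    exists x; eauto using lt_tr.
  - intros b n z Hb Hz; destruct (proj2 (proj2 (HB' b)) n z Hz) as [z' [H1 H2]].
    exists z'; eauto using lt_tr.
Qed.

End RegularCardinal.

(** * The ultrametrics of a family of sequences *)

Section TreeMetric.

Variables (L : Type) (eta : L -> nat -> L) (s : nat -> R).
Hypothesis eta_inj : forall x y, (forall n, eta x n = eta y n) -> x = y.
Hypothesis s_pos : forall n, 0 < s n.
Hypothesis s_decr : forall n, s (S n) <= s n.

Definition first_difference (x y : L) : nat :=
  epsilon (inhabits 0%nat) (fun n => eta x n <> eta y n /\ agree L eta n x y).

Definition tree_dist (x y : L) : R :=
  if excluded_middle_informative (x = y) then 0 else s (first_difference x y).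

Lemma s_antitone m n : (m <= n)%nat -> s n <= s m.
Proof.
  induction 1; [lra|]; specialize (s_decr m0); lra.
Qed.

Lemma first_differenceP x y : x <> y ->
  eta x (first_difference x y) <> eta y (first_difference x y) /\
  agree L eta (first_difference x y) x y.
Proof.
  intros Hxy.
  apply (epsilon_spec (inhabits 0%nat) (fun n => eta x n <> eta y n /\ agree L eta n x y)).
  assert (H : exists n, eta x n <> eta y n).
  { apply not_all_ex_not; intros H; apply Hxy, eta_inj, H. }
  destruct H as [n Hn]; revert n Hn.
  apply (well_founded_ind PeanoNat.Nat.lt_wf_0 (fun n => eta x n <> eta y n -> _)).
  intros n IH Hn.
  destruct (classic (agree L eta n x y)) as [H|H]; [eauto|].
  apply not_all_ex_not in H; destruct H as [k H].
  apply imply_to_and in H; destruct H; eauto.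
Qed.

Lemma tree_dist_ge x y n : eta x n <> eta y n -> s n <= tree_dist x y.
Proof.
  intros H; unfold tree_dist; destruct (excluded_middle_informative (x = y)) as [->|Hxy].
  - contradiction.
  - apply s_antitone; destruct (first_differenceP x y Hxy) as [_ Ha].
    destruct (PeanoNat.Nat.le_gt_cases (first_difference x y) n); auto.
    exfalso; auto.
Qed.

Lemma tree_dist_le x y n : agree L eta n x y -> tree_dist x y <= s n.
Proof.
  intros H; unfold tree_dist; destruct (excluded_middle_informative (x = y)) as [->|Hxy].
  - apply Rlt_le, s_pos.
  - apply s_antitone; destruct (first_differenceP x y Hxy) as [Hd _].
    destruct (PeanoNat.Nat.le_gt_cases n (first_difference x y)); auto.
    exfalso; auto.
Qed.

Lemma tree_dist_ge0 x y : 0 <= tree_dist x y.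
Proof.
  unfold tree_dist; destruct (excluded_middle_informative (x = y)); [lra|].
  apply Rlt_le, s_pos.
Qed.

(** Where [x] and [z] first differ, [y] must differ from one of them. *)
Lemma tree_dist_ultra x y z : tree_dist x z <= Rmax (tree_dist x y) (tree_dist y z).
Proof.
  unfold tree_dist at 1; destruct (excluded_middle_informative (x = z)) as [->|Hxz].
  - eapply Rle_trans; [apply (tree_dist_ge0 z y)|apply Rmax_l].
  - destruct (first_differenceP x z Hxz) as [Hd _].
    destruct (classic (eta x (first_difference x z) = eta y (first_difference x z)))
      as [H|H].
    + eapply Rle_trans; [|apply Rmax_r]; apply tree_dist_ge; congruence.
    + eapply Rle_trans; [|apply Rmax_l]; apply tree_dist_ge; auto.
Qed.

Lemma tree_dist_sym x y : tree_dist x y = tree_dist y x.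
Proof.
  destruct (classic (x = y)) as [->|Hxy]; [reflexivity|].
  (* [epsilon] need not choose symmetrically by definition, so symmetry is drawn from the
     estimates. *)
  assert (H : forall x y, x <> y -> tree_dist y x <= tree_dist x y).
  { clear x y Hxy; intros x y Hxy; unfold tree_dist at 2.
    destruct (excluded_middle_informative (x = y)); [contradiction|].
    apply tree_dist_le; intros k Hk; symmetry; now apply first_differenceP. }
  apply Rle_antisym; apply H; auto.
Qed.

Lemma tree_dist_ultrametric : is_ultrametric tree_dist.
Proof.
  split; [|exact tree_dist_ultra]; repeat split.
  - exact tree_dist_ge0.
  - unfold tree_dist; destruct (excluded_middle_informative (x = y)); auto.
    intros H; specialize (s_pos (first_difference x y)); lra.
  - intros ->; unfold tree_dist; destruct (excluded_middle_informative (y = y)); tauto.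
  - exact tree_dist_sym.
  - intros x y z; eapply Rle_trans; [apply (tree_dist_ultra x y z)|].
    specialize (tree_dist_ge0 x y); specialize (tree_dist_ge0 y z).
    intros; apply Rmax_lub; lra.
Qed.

End TreeMetric.

(** * Coding a real by an ultrametric *)

(* Bit [b] of [A] is repeated at the positions [<b, m>] for all [m], where a jump
   by the factor [1 + m^2] is recognised after any distortion [2 K^2 <= m]. *)
Fixpoint code_scale (A : nat -> bool) (n : nat) : R :=
  match n with
  | 0%nat => 1
  | S n => if A (fst (Cantor.of_nat n))
           then code_scale A n / (1 + INR (snd (Cantor.of_nat n)) ^ 2)
           else code_scale A n
  end.

Lemma code_scale_pos A n : 0 < code_scale A n.
Proof.
  induction n; cbn [code_scale]; [lra|].
  destruct (A (fst (Cantor.of_nat n))); auto.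
  apply Rdiv_lt_0_compat; auto; nra.
Qed.

Lemma code_scale_decr A n : code_scale A (S n) <= code_scale A n.
Proof.
  specialize (code_scale_pos A n) as H; cbn [code_scale].
  destruct (A (fst (Cantor.of_nat n))); [|lra].
  set (q := INR _); apply Rmult_le_reg_r with (1 + q ^ 2); [nra|].
  replace (code_scale A n / (1 + q ^ 2) * (1 + q ^ 2)) with (code_scale A n)
    by (field; nra).
  specialize (pow2_ge_0 q) as Hq; nra.
Qed.

(** The distance from [y] to the points below [alpha] drops by a factor of about [t] from stage [j]
    to [S j]. Neither [f] nor [K] occurs, which keeps the decoding parameters few. *)
Definition jump (L : Type) (lt : L -> L -> Prop) (e : L -> L -> R)
    (alpha : nat -> L) (y : L) (t : R) (j : nat) : Prop :=
  exists z, lt z (alpha (S j)) /\ forall w, lt w (alpha j) -> t * e y z < e y w.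

Lemma bilipschitz_decodes (L : Type) (lt : L -> L -> Prop) (eta : L -> nat -> L)
    (A : nat -> bool) (e : L -> L -> R) (K : R) (f : L -> L) :
  regular_cardinal lt -> aleph1_lt lt ->
  (forall x n, ~ lt x (eta x n)) ->
  (forall x y, (forall n, eta x n = eta y n) -> x = y) ->
  (forall E, club L lt E -> exists x, (exists b, lt b (eta x 0%nat)) /\
     (forall n, lt (eta x n) (eta x (S n))) /\ forall n, E (eta x n)) ->
  is_metric e -> 1 <= K ->
  (forall x y, tree_dist L eta (code_scale A) x y / K <= e (f x) (f y)
     <= K * tree_dist L eta (code_scale A) x y) ->
  exists x m, forall b,
    A b = true <-> jump L lt e (eta x) (f x) (INR m) (Cantor.to_nat (b, m)).
Proof.
  intros Lreg Lal eta_le eta_inj guess [e0 [e1 [e2 e3]]] HK Hf.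
  set (s := code_scale A) in *; set (d := tree_dist L eta s) in *.
  assert (s_pos : forall n, 0 < s n) by (apply code_scale_pos).
  assert (s_decr : forall n, s (S n) <= s n) by (apply code_scale_decr).
  destruct (ex_reflecting_club L lt Lreg Lal eta f
    (fun j w x => e (f x) w < s j / (2 * K))) as [E [HE Hrefl]].
  destruct (guess E HE) as [x [[b0 Hb0] [Hinc HxE]]].
  assert (Hmono : forall k n, (k < n)%nat -> lt (eta x k) (eta x n)).
  { intros k n H; induction H; auto; apply (lt_tr _ _ Lreg _ (eta x m)); auto. }
  assert (Hup : forall n, exists z, lt z (eta x n) /\ e (f x) z <= K * s n).
  { intros n; destruct (Hrefl _ (HxE n)) as [Hfc [_ Hpre]].
    assert (H : exists z', lt z' (eta x n) /\ agree L eta n z' x).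
    (* The empty prefix only needs [eta x 0] not to be least; a prefix of length [S n] is bounded by
       its last entry [eta x n]. *)
    { destruct n.
      - apply Hpre with b0; auto; intros; lia.
      - apply Hpre with (eta x n); auto; intros k Hk.
        destruct (PeanoNat.Nat.eq_dec k n) as [->|Hne].
        + apply (lt_irr _ _ Lreg).
        + apply (lt_le _ _ Lreg), Hmono; lia. }
    destruct H as [z [Hz Ha]]; exists (f z); split; auto.
    apply Rle_trans with (K * d x z); [apply Hf|].
    apply Rmult_le_compat_l; [lra|]; apply tree_dist_le; auto.
    intros k Hk; symmetry; auto. }
  assert (Hlow : forall n w, lt w (eta x n) -> s n / (2 * K) <= e (f x) w).
  (* If [f x] were too close to [w], some [x'] below [eta x n] would have [f x'] equally close,
     giving [d x x' < s n]. But [eta x' n] is at most [x'], so [x] and [x'] differ at [n]. *)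
  { intros n w Hw; apply Rnot_lt_le; intros Hlt.
    destruct (proj1 (proj2 (Hrefl _ (HxE n))) n w Hw) as [x' [Hx' Hd]]; eauto.
    assert (H1 : s n <= d x x').
    { apply tree_dist_ge; auto; intros E0.
      apply (eta_le x' n); rewrite <- E0; auto. }
    assert (H2 : e (f x) (f x') < s n / K).
    { specialize (e3 (f x) w (f x')); rewrite (e2 w) in e3.
      replace (s n / K) with (s n / (2 * K) + s n / (2 * K)) by (field; lra); lra. }
    assert (H3 : s n / K <= d x x' / K).
    { apply Rmult_le_compat_r; auto; apply Rlt_le, Rinv_0_lt_compat; lra. }
    specialize (Hf x x'); lra. }
  (* The two estimates lose a factor [2 * K ^ 2 < m]: a true bit shrinks [s] by [1 + m ^ 2], more
     than [m] times this loss, while with a false bit no ratio exceeds the loss. *)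
  destruct (INR_unbounded (2 * K ^ 2)) as [m Hm].
  exists x, m; intros b; set (j := Cantor.to_nat (b, m)).
  assert (Hj : s (S j) = if A b then s j / (1 + INR m ^ 2) else s j).
  { unfold s, j; cbn [code_scale]; rewrite Cantor.cancel_of_to; reflexivity. }
  assert (Hsj := s_pos j).
  split.
  - intros HA; rewrite HA in Hj.
    destruct (Hup (S j)) as [z [Hz Hez]]; exists z; split; auto.
    intros w Hw; apply Rlt_le_trans with (s j / (2 * K)); [|auto].
    apply Rle_lt_trans with (INR m * (K * s (S j))).
    { apply Rmult_le_compat_l; [apply pos_INR|auto]. }
    rewrite Hj; set (q := INR m) in *.
    apply Rmult_lt_reg_r with (2 * K * (1 + q ^ 2)); [nra|].
    replace (q * (K * (s j / (1 + q ^ 2))) * (2 * K * (1 + q ^ 2)))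
      with (s j * (q * (2 * K ^ 2))) by (field; apply Rgt_not_eq; nra).
    replace (s j / (2 * K) * (2 * K * (1 + q ^ 2))) with (s j * (1 + q ^ 2))
      by (field; lra).
    apply Rmult_lt_compat_l; auto; nra.
  - intros [z [Hz Hjump]]; destruct (A b); auto; exfalso.
    destruct (Hup j) as [w [Hw Hew]]; specialize (Hjump w Hw).
    specialize (Hlow (S j) z Hz); rewrite Hj in Hlow.
    assert (H : s j * K <= INR m * e (f x) z).
    { apply Rle_trans with (2 * K ^ 2 * (s j / (2 * K))).
      - right; field; lra.
      - apply Rmult_le_compat; auto; try lra; try nra.
        apply Rlt_le, Rdiv_lt_0_compat; lra. }
    lra.
Qed.

(** * Diagonalisation and universal spaces *)

Lemma ex_non_embeddable_ultrametric (L : Type) (lt : L -> L -> Prop) (I : Type)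
    (dI : I -> L -> L -> R) :
  regular_cardinal lt -> aleph1_lt lt -> ~ card_le continuum L ->
  ~ card_le continuum I -> (forall i, is_metric (dI i)) ->
  exists d : L -> L -> R, is_ultrametric d /\
    forall (i : I) (K : R) (f : L -> L), 1 <= K ->
      ~ (forall x y, d x y / K <= dI i (f x) (f y) <= K * d x y).
Proof.
  intros Lreg Lal HL HI Hd.
  destruct (ex_guessing_sequences L lt Lreg Lal) as [eta [eta_le [eta_inj guess]]].
  (* The parameters are the metric, the point [x], a guess [y] for [f x], and the threshold [m]. *)
  set (decode := fun (p : I * (L * (L * nat))) (b : nat) =>
    let '(i, (x, (y, m))) := p in
    decide_bool (jump L lt (dI i) (eta x) y (INR m) (Cantor.to_nat (b, m)))).
  assert (Hnat : ~ card_le continuum nat).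
  { intros [g Hg].
    set (diag := fun n => decide_bool (exists A : continuum, g A = n /\ A n = false)).
    destruct (diag (g diag)) eqn:E.
    - destruct (proj1 (decide_boolE _) E) as [A [HA HA']]; apply Hg in HA; congruence.
    - assert (E' : diag (g diag) = true) by (apply decide_boolE; eauto); congruence. }
  assert (HA : exists A, forall p, decode p <> A).
  { apply NNPP; intros Hn.
    apply (not_card_le_prod continuum I (L * (L * nat))); auto.
    - repeat apply not_card_le_prod; auto.
    - apply (card_le_of_surjection _ _ decode); intros A; apply NNPP; intros H.
      apply Hn; exists A; intros p Hp; eauto. }
  destruct HA as [A HA].
  exists (tree_dist L eta (code_scale A)); split.
  - apply tree_dist_ultrametric; auto using code_scale_pos, code_scale_decr.
  - intros i K f HK Hf.
    destruct (bilipschitz_decodes L lt eta A (dI i) K f) as [x [m Hx]]; auto.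
    apply (HA (i, (x, (f x, m)))); apply functional_extensionality; intros b.
    unfold decode; apply eq_true_iff_eq; rewrite decide_boolE; symmetry; apply Hx.
Qed.

(** A universal space of size [L] is carried over to [L] by a bijection and treated as a family of
    one metric, indexed by [unit]. *)
Lemma no_universal_metric_space (L : Type) (lt : L -> L -> Prop) :
  regular_cardinal lt -> aleph1_lt lt -> ~ card_le continuum L ->
  ~ exists (Y : Type) (e : Y -> Y -> R), card_eq Y L /\ is_metric e /\
      forall (X : Type) (d : X -> X -> R), card_eq X L -> is_ultrametric d ->
        exists (K : R) (f : X -> Y), bilip_embedding d e K f.
Proof.
  intros Lreg Lal HL [Y [e [[g [g_inj g_surj]] [[e0 [e1 [e2 e3]]] Huniv]]]].
  destruct (choice _ g_surj) as [h Hh].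
  destruct (ex_non_embeddable_ultrametric L lt unit (fun _ x y => e (h x) (h y)))
    as [d [Hd Hno]]; auto.
  - intros [k Hk].
    assert (E : (fun _ : nat => true) = (fun _ => false)).
    { apply Hk; destruct (k (fun _ => true)), (k (fun _ => false)); reflexivity. }
    apply (f_equal (fun u => u 0%nat)) in E; discriminate.
  - intros _; repeat split; auto.
    + intros H; apply e1 in H; rewrite <- (Hh x), <- (Hh y), H; reflexivity.
    + intros ->; now apply e1.
  - destruct (Huniv L d) as [K [f [HK [f_inj Hf]]]]; auto.
    { exists (fun x => x); eauto. }
    apply (Hno tt K (fun x => g (f x)) HK); intros x y.
    assert (E : forall z, h (g z) = z) by (intros z; apply g_inj; auto).
    rewrite !E; apply Hf.
Qed.

Lemma almost_isometric_bilip (X Y : Type) (d : X -> X -> R) (e : Y -> Y -> R) :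
  is_metric d -> is_metric e -> almost_isometric_embeds d e ->
  exists (K : R) (f : X -> Y), bilip_embedding d e K f.
Proof.
  (* Any distortion bound above 1 would do; 2 serves as [K]. *)
  intros [_ [d1 _]] [_ [e1 _]] H; destruct (H 2) as [f [f_inj Hf]]; [lra|].
  exists 2, f; split; [lra|split; auto]; intros x y.
  destruct (classic (x = y)) as [->|Hxy].
  - rewrite (proj2 (d1 y y) eq_refl), (proj2 (e1 (f y) (f y)) eq_refl); lra.
  - destruct (Hf x y Hxy); lra.
Qed.

Theorem theorem6p2 (L : Type) (lt : L -> L -> Prop) (I : Type)
  (dI : I -> L -> L -> R) :
  regular_cardinal lt -> aleph1_lt lt -> card_lt L continuum ->
  card_lt I continuum ->
  (forall i, is_metric (dI i)) ->
  (exists d : L -> L -> R, is_ultrametric d /\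
     forall (i : I) (K : R), 1 <= K ->
       ~ (exists f : L -> L, (forall x y, f x = f y -> x = y) /\
            forall x y, d x y / K <= dI i (f x) (f y) <= K * d x y))
  /\
  (~ exists (Y : Type) (e : Y -> Y -> R), card_eq Y L /\ is_metric e /\
       forall (X : Type) (d : X -> X -> R), card_eq X L -> is_ultrametric d ->
         exists (K : R) (f : X -> Y), bilip_embedding d e K f)
  /\
  (~ exists (Y : Type) (e : Y -> Y -> R), card_eq Y L /\ is_metric e /\
       forall (X : Type) (d : X -> X -> R), card_eq X L -> is_ultrametric d ->
         almost_isometric_embeds d e).
Proof.
  intros Lreg Lal [_ HL] [_ HI] Hd; split; [|split].
  - destruct (ex_non_embeddable_ultrametric L lt I dI) as [d [Hu Hno]]; auto.
    exists d; split; auto; intros i K HK [f [_ Hf]]; exact (Hno i K f HK Hf).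
  - now apply no_universal_metric_space with lt.
  - intros [Y [e [HY [He Huniv]]]].
    apply (no_universal_metric_space L lt); auto.
    exists Y, e; split; [|split]; auto; intros X d HX Hdu.
    apply almost_isometric_bilip; auto; apply Hdu.
Qed.
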